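(* Let $d\ge 1$ and let $\Lambda=\{\Lambda_t\}_{t\ge 0}$ be a family of completely positive trace preserving linear maps $\Lambda_t:B(\mathbb{C}^d)\to B(\mathbb{C}^d)$ with $\Lambda_0=\mathcal{I}_d$, such that for every $t\ge 0$ the linear map $\Lambda_t$ is bijective on $B(\mathbb{C}^d)$. Then $\Lambda$ is CP-divisible if and only if for any two states $\rho_1,\rho_2$ on $\mathbb{C}^{d+1}\otimes\mathbb{C}^d$ and any two times $0\le s<t$, $$\|(\mathcal{I}_{d+1}\otimes\Lambda_s)(\rho_1-\rho_2)\|_1\ \ge\ \|(\mathcal{I}_{d+1}\otimes\Lambda_t)(\rho_1-\rho_2)\|_1 .$$
   Context: $B(\mathbb{C}^n)$ is the space of linear operators on $\mathbb{C}^n$; a state is a positive semidefinite operator of trace one; $\mathcal{I}_n$ is the identity map on $B(\mathbb{C}^n)$; $\|\cdot\|_1$ is the trace norm. A family $\{\Lambda_t\}$ is CP-divisible if for all $0\le s\le t$ there is a completely positive and trace preserving linear map $V_{t,s}:B(\mathbb{C}^d)\to B(\mathbb{C}^d)$ with $\Lambda_t=V_{t,s}\Lambda_s$. Bijectivity of $\Lambda_t$ means invertibility as a linear map on $B(\mathbb{C}^d)$; the inverse need not be positive. *)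

(* Defs.v *)
From HB Require Import structures.
From mathcomp Require Import all_boot all_order all_algebra.
From mathcomp Require Import complex mxtens.
From mathcomp Require Import reals.

Set Implicit Arguments.
Unset Strict Implicit.
Unset Printing Implicit Defensive.

Import Order.TTheory GRing.Theory Num.Theory.
Local Open Scope ring_scope.
Local Open Scope sesquilinear_scope.

(* Operators on C^n are matrices 'M[C]_n acting on column vectors, and        *)
(* C^m (x) C^n is C^(m * n) with basis e_i (x) e_j indexed by                 *)
(* mxtens_index (i, j), so that A (x) B is the Kronecker product A *t B.      *)
(* The order on a numClosedFieldType C satisfies                              *)
(* x <= y <-> 'Im x = 'Im y /\ 'Re x <= 'Re y.                                *)

Section Quantum.
Variable C : numClosedFieldType.

Definition psdmx n (A : 'M[C]_n) : Prop :=
  A \is hermsymmx /\ forall v : 'cV[C]_n, 0 <= (v ^t* *m A *m v) 0 0.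

Definition state n (rho : 'M[C]_n) : Prop := psdmx rho /\ \tr rho = 1.

(* Spectral functional calculus; only meaningful for A positive semidefinite, *)
(* where it is the positive semidefinite square root (sqrtmx_psd, sqrtmxK).   *)
Definition sqrtmx n (A : 'M[C]_n) : 'M[C]_n :=
  invmx (spectralmx A) *m diag_mx (map_mx sqrtC (spectral_diag A))
    *m spectralmx A.

Definition trnorm n (A : 'M[C]_n) : C := \tr (sqrtmx (A ^t* *m A)).

Definition mxtens_block k n (X : 'M[C]_(k * n)) (i j : 'I_k) : 'M[C]_n :=
  \matrix_(a, b) X (mxtens_index (i, a)) (mxtens_index (j, b)).

(* id_k (x) Phi applies Phi to each n x n block; see idtens_tens.             *)
Definition idtens k m n (Phi : 'M[C]_m -> 'M[C]_n) (X : 'M[C]_(k * m)) :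
    'M[C]_(k * n) :=
  \matrix_(p, q)
    Phi (mxtens_block X (mxtens_unindex p).1 (mxtens_unindex q).1)
      (mxtens_unindex p).2 (mxtens_unindex q).2.

Definition completely_positive m n (Phi : 'M[C]_m -> 'M[C]_n) : Prop :=
  forall (k : nat) (X : 'M[C]_(k * m)), psdmx X -> psdmx (idtens Phi X).

Definition trace_preserving m n (Phi : 'M[C]_m -> 'M[C]_n) : Prop :=
  forall X, \tr (Phi X) = \tr X.

Definition cptp m n (Phi : {linear 'M[C]_m -> 'M[C]_n}) : Prop :=
  completely_positive Phi /\ trace_preserving Phi.

Lemma idtens_is_linear k m n (Phi : {linear 'M[C]_m -> 'M[C]_n}) :
  linear (@idtens k m n Phi).
Proof.
move=> c X Y; apply/matrixP => p q; rewrite !mxE.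
set i := (mxtens_unindex p).1; set j := (mxtens_unindex q).1.
have -> : mxtens_block (c *: X + Y) i j
        = c *: mxtens_block X i j + mxtens_block Y i j.
  by apply/matrixP => a b; rewrite !mxE.
by rewrite linearP !mxE.
Qed.

Lemma idtens_tens k m n (Phi : {linear 'M[C]_m -> 'M[C]_n})
    (A : 'M[C]_k) (B : 'M[C]_m) :
  idtens Phi (A *t B) = A *t Phi B.
Proof.
apply/matrixP => p q; rewrite !mxE.
set i := (mxtens_unindex p).1; set j := (mxtens_unindex q).1.
have -> : mxtens_block (A *t B) i j = A i j *: B.
  by apply/matrixP => a b; rewrite !mxE !mxtens_indexK.
by rewrite linearZ !mxE.
Qed.

Lemma psdmx_spectralE n (A : 'M[C]_n) : psdmx A ->
  A = invmx (spectralmx A) *m diag_mx (spectral_diag A) *m spectralmx A.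
Proof.
by move=> [/hermitian_normalmx /orthomx_spectralP].
Qed.

Lemma psdmx_gram m n (A : 'M[C]_(m, n)) : psdmx (A ^t* *m A).
Proof.
split=> [|v].
  apply/is_hermitianmxP; rewrite expr0 scale1r.
  by rewrite trmx_mul map_mxM /= trmxCK.
rewrite mulmxA -mulmxA -map_mxM -trmx_mul mxE; apply: sumr_ge0 => i _.
by rewrite !mxE mulrC mul_conjC_ge0.
Qed.

Lemma psdmx_spectral_ge0 n (A : 'M[C]_n) i :
  psdmx A -> 0 <= spectral_diag A 0 i.
Proof.
move=> hA; have U := spectral_unitarymx A.
have [_ /(_ ((spectralmx A) ^t* *m delta_mx i 0))] := hA.
rewrite {2}(psdmx_spectralE hA) (invmx_unitary U).
rewrite trmx_mul map_mxM /= trmxCK !mulmxA.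
rewrite -[_ *m spectralmx A *m _]mulmxA (unitarymxP U) mulmx1.
rewrite -[_ *m spectralmx A *m _]mulmxA (unitarymxP U) mulmx1.
rewrite mxE (bigD1 i) //= big1 ?addr0 => [|j ji]; last first.
  by rewrite [delta_mx _ _ _ _]mxE (negPf ji) /= mulr0.
rewrite mul_mx_diag !mxE !eqxx /= conjC1 mul1r mulr1.
by [].
Qed.

Lemma sqrtmxK n (A : 'M[C]_n) : psdmx A -> sqrtmx A *m sqrtmx A = A.
Proof.
move=> hA; have S := spectral_unit A.
rewrite {3}(psdmx_spectralE hA) /sqrtmx !mulmxA mulmxK //; congr (_ *m _).
rewrite -!mulmxA; congr (_ *m _); rewrite mulmx_diag; congr diag_mx.
by apply/rowP => i; rewrite !mxE -expr2 sqrtCK.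
Qed.

Lemma sqrtmx_psd n (A : 'M[C]_n) : psdmx A -> psdmx (sqrtmx A).
Proof.
move=> hA; have U := spectral_unitarymx A.
pose D := diag_mx (map_mx (sqrtC \o sqrtC) (spectral_diag A)).
suff -> : sqrtmx A = (D *m spectralmx A) ^t* *m (D *m spectralmx A).
  exact: psdmx_gram.
rewrite trmx_mul map_mxM /= tr_diag_mx -(invmx_unitary U) /sqrtmx !mulmxA.
congr (_ *m _); rewrite -!mulmxA; congr (_ *m _).
rewrite map_diag_mx mulmx_diag; congr diag_mx.
apply/rowP => j; rewrite !mxE /=.
have h : 0 <= sqrtC (sqrtC (spectral_diag A 0 j)).
  by rewrite !sqrtC_ge0 psdmx_spectral_ge0.
by rewrite (CrealP (ger0_real h)) -expr2 sqrtCK.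
Qed.

End Quantum.

(* Families indexed by t >= 0 are functions on R whose values at t < 0 are    *)
(* unconstrained.                                                             *)
Definition cp_divisible (R : realType) (d : nat)
    (Lambda : R -> {linear 'M[R[i]]_d -> 'M[R[i]]_d}) : Prop :=
  forall s t : R, 0 <= s -> s <= t ->
  exists V : {linear 'M[R[i]]_d -> 'M[R[i]]_d},
    cptp V /\ forall X, Lambda t X = V (Lambda s X).

(* Main.v *)
From HB Require Import structures.
Require Import Defs.
From mathcomp Require Import all_boot all_order all_algebra.
From mathcomp Require Import complex mxtens.
From mathcomp Require Import reals ring.
Import Order.TTheory GRing.Theory Num.Theory.
Local Open Scope ring_scope.
Local Open Scope sesquilinear_scope.

Set Implicit Arguments.
Unset Strict Implicit.
Unset Printing Implicit Defensive.

(* The trace norm of a hermitian matrix is the least value of tr P + tr N     *)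
(* over decompositions P - N into positive semidefinite matrices; hence it is *)
(* contracted by positive trace-preserving maps, which gives one direction.   *)
(* Conversely, put V = Lambda_t o Lambda_s^-1. Contractivity on differences   *)
(* of states pulls back along Lambda_s and says that id (x) V contracts the   *)
(* trace norm on all traceless hermitian matrices. Apply it to the            *)
(* unnormalized maximally entangled projector on ancilla levels 1, ..., d     *)
(* minus d times a pure state on level 0, which has trace norm at most 2d:    *)
(* the image is P - N with tr P = tr N <= d. Compressed to levels 1, ..., d   *)
(* it is the Choi matrix of V, of trace d, so P must lie there with its whole *)
(* trace while the compression of N vanishes. Thus the Choi matrix is         *)
(* positive semidefinite and V is completely positive.                        *)

(** The description of the trace norm as a least value splits into [trnorm_jordan] (attained) and
    [trnorm_sub_le] (lower bound); [trnorm_idtens_le] is the resulting contraction. For the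
    converse, [hermsymmx_state_diff] rescales a traceless hermitian matrix to a difference of
    states, [psdmx_choi] does the trace count, and [choi_completely_positive] concludes. The ancilla
    level beyond the first [d] makes the test matrix traceless without disturbing the block that
    becomes the Choi matrix. *)

Section TraceNorm.
Variable C : numClosedFieldType.

(** * Positive semidefinite matrices and the trace norm *)

Lemma hermsymmxP n (A : 'M[C]_n) : reflect (A ^t* = A) (A \is hermsymmx).
Proof.
by apply: (iffP (is_hermitianmxP _ _ _)); rewrite expr0 scale1r => /esym.
Qed.

Lemma psdmxD n (A B : 'M[C]_n) : psdmx A -> psdmx B -> psdmx (A + B).
Proof.
move=> [/hermsymmxP hA pA] [/hermsymmxP hB pB]; split=> [|v].
  by apply/hermsymmxP; rewrite linearD map_mxD /= hA hB.
by rewrite mulmxDr mulmxDl mxE addr_ge0.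
Qed.

Lemma psdmxZ n (c : C) (A : 'M[C]_n) : 0 <= c -> psdmx A -> psdmx (c *: A).
Proof.
move=> c0 [/hermsymmxP hA pA]; split=> [|v].
  apply/hermsymmxP; rewrite linearZ /= map_mxZ hA.
  by congr (_ *: _); apply/CrealP/ger0_real.
by rewrite -scalemxAr -scalemxAl mxE mulr_ge0.
Qed.

Lemma hermsymmx_psdB n (P N : 'M[C]_n) :
  psdmx P -> psdmx N -> P - N \is hermsymmx.
Proof.
move=> [/hermsymmxP hP _] [/hermsymmxP hN _]; apply/hermsymmxP.
by rewrite linearB map_mxB /= hP hN.
Qed.

Lemma psdmx_gramE n (A : 'M[C]_n) :
  psdmx A -> exists G : 'M[C]_n, A = G ^t* *m G.
Proof.
move=> hA; exists (sqrtmx A); have [/hermsymmxP-> _] := sqrtmx_psd hA.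
by rewrite sqrtmxK.
Qed.

Lemma gram_diagE m n (G : 'M[C]_(m, n)) i :
  (G ^t* *m G) i i = \sum_k `|G k i| ^+ 2.
Proof. by rewrite mxE; apply: eq_bigr => k _; rewrite !mxE mulrC normCK. Qed.

Lemma psdmx_diag_ge0 n (A : 'M[C]_n) i : psdmx A -> 0 <= A i i.
Proof.
move=> /psdmx_gramE[G ->]; rewrite gram_diagE.
by apply: sumr_ge0 => k _; rewrite exprn_ge0.
Qed.

Lemma psdmx_trace_ge0 n (A : 'M[C]_n) : psdmx A -> 0 <= \tr A.
Proof. by move=> hA; apply: sumr_ge0 => i _; apply: psdmx_diag_ge0. Qed.

Lemma psdmx_trace_eq0 n (A : 'M[C]_n) : psdmx A -> \tr A = 0 -> A = 0.
Proof.
move=> hA tA; have [G eA] := psdmx_gramE hA.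
suff G0 : G = 0 by rewrite eA G0 mulmx0.
apply/matrixP => k i; rewrite mxE; apply/eqP; rewrite -normr_eq0 -sqrf_eq0.
have /eqP := tA; rewrite psumr_eq0 => [|j _]; last exact: psdmx_diag_ge0.
move=> /allP/(_ i (mem_index_enum _)) /=; rewrite eA gram_diagE.
rewrite psumr_eq0 => [|j _]; last by rewrite exprn_ge0.
by move=> /allP/(_ k (mem_index_enum _)).
Qed.

Lemma psdmx_mxsub m n (f : 'I_m -> 'I_n) (A : 'M[C]_n) :
  psdmx A -> psdmx (mxsub f f A).
Proof.
move=> /psdmx_gramE[G ->].
suff -> : mxsub f f (G ^t* *m G) = (colsub f G) ^t* *m colsub f G.
  exact: psdmx_gram.
by apply/matrixP => i j; rewrite !mxE; apply: eq_bigr => k _; rewrite !mxE.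
Qed.

Lemma psdmx_trace_mxsub_le m n (f : 'I_m -> 'I_n) (A : 'M[C]_n) :
  injective f -> psdmx A -> \tr (mxsub f f A) <= \tr A.
Proof.
move=> f_inj hA; rewrite [leRHS](bigID (mem (f @: setT))) /=.
rewrite big_imset /=; last by move=> ? ? _ _; apply: f_inj.
rewrite (eq_bigl xpredT) => [|i]; last by rewrite inE.
rewrite [leLHS](eq_bigr (fun i => A (f i) (f i))) => [|i _]; last first.
  by rewrite mxE.
by rewrite lerDl sumr_ge0 // => i _; apply: psdmx_diag_ge0.
Qed.

(* The change of basis [M] satisfies [M i j * s j = t i * M i j], and such    *)
(* relations survive the replacement of [s] and [t] by [f s] and [f t].       *)
Lemma sum_similar_diag n (P Q : 'M[C]_n) (s t : 'rV[C]_n) (f : C -> C) :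
  P \in unitmx -> Q \in unitmx ->
  invmx P *m diag_mx s *m P = invmx Q *m diag_mx t *m Q ->
  \sum_i f (s 0 i) = \sum_i f (t 0 i).
Proof.
move=> uP uQ eqPQ; pose M := Q *m invmx P.
have uM : M \in unitmx by rewrite unitmx_mul uQ unitmx_inv.
have eM : M *m diag_mx s = diag_mx t *m M.
  move/(congr1 (fun X => Q *m X *m invmx P)): eqPQ.
  by rewrite !mulmxA mulmxK // mulmxV // mul1mx -!mulmxA mulmxA.
clearbody M.
have eMf : M *m diag_mx (map_mx f s) = diag_mx (map_mx f t) *m M.
  apply/matrixP => i j; move/matrixP/(_ i j): eM.
  rewrite !mul_mx_diag !mul_diag_mx !mxE.
  have [->|nz] := eqVneq (M i j) 0; first by rewrite !(mul0r, mulr0).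
  by rewrite ![_ * M i j]mulrC => /(mulfI nz) ->.
have trf (r : 'rV[C]_n) : \sum_i f (r 0 i) = \tr (diag_mx (map_mx f r)).
  by rewrite mxtrace_diag; apply: eq_bigr => i _; rewrite mxE.
by rewrite !trf -[diag_mx _ in LHS](mulKmx uM) eMf mxtrace_mulC mulmxK.
Qed.

(** An eigenbasis of [A] diagonalizes [A ^t* *m A] with entries the squared moduli of the
    eigenvalues. It may differ from the basis used by [sqrtmx], but by [sum_similar_diag] the sum of
    the roots is the same. *)
Lemma trnorm_normal n (A : 'M[C]_n) : A \is normalmx ->
  trnorm A = \sum_i `|spectral_diag A 0 i|.
Proof.
move=> nA; set B := A ^t* *m A.
have hB : psdmx B := psdmx_gram A.
have uA := spectral_unitarymx A.
rewrite /trnorm /sqrtmx -/B mxtrace_mulC mulmxA mulmxV ?spectral_unit //.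
rewrite mul1mx mxtrace_diag.
pose t : 'rV[C]_n := \row_i (`|spectral_diag A 0 i| ^+ 2).
have eB : B = invmx (spectralmx A) *m diag_mx t *m spectralmx A.
  rewrite /B {1 2}(orthomx_spectralP nA) (invmx_unitary uA).
  rewrite !trmx_mul !map_mxM /= trmxCK tr_diag_mx map_diag_mx !mulmxA.
  rewrite mulmxtVK // -[_ *m diag_mx _ *m diag_mx _]mulmxA mulmx_diag.
  by congr (_ *m diag_mx _ *m _); apply/rowP => i; rewrite !mxE normCK mulrC.
transitivity (\sum_i sqrtC (spectral_diag B 0 i)).
  by apply: eq_bigr => i _; rewrite mxE.
rewrite (sum_similar_diag _ (spectral_unit B) (spectral_unit A) (t := t)).
  by apply: eq_bigr => i _; rewrite mxE sqrCK.
by rewrite -eB -(psdmx_spectralE hB).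
Qed.

Lemma trnorm_jordan n (A : 'M[C]_n) : A \is hermsymmx ->
  exists P N : 'M[C]_n,
    [/\ psdmx P, psdmx N, A = P - N & trnorm A = \tr P + \tr N].
Proof.
move=> hA; have nA := hermitian_normalmx hA.
have uA := spectral_unitarymx A.
have rA i : spectral_diag A 0 i \is Num.real.
  exact/mxOverP/hermitian_spectral_diag_real.
pose D (g : C -> C) : 'M[C]_n :=
  invmx (spectralmx A) *m diag_mx (map_mx g (spectral_diag A)) *m spectralmx A.
have trD g : \tr (D g) = \sum_i g (spectral_diag A 0 i).
  rewrite /D mxtrace_mulC mulmxA mulmxV ?spectral_unit // mul1mx mxtrace_diag.
  by apply: eq_bigr => i _; rewrite mxE.
have psdD g : (forall i, 0 <= g (spectral_diag A 0 i)) -> psdmx (D g).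
  move=> g0; pose E := diag_mx (map_mx (sqrtC \o g) (spectral_diag A)).
  suff -> : D g = (E *m spectralmx A) ^t* *m (E *m spectralmx A).
    exact: psdmx_gram.
  rewrite trmx_mul map_mxM /= tr_diag_mx /D (invmx_unitary uA) !mulmxA.
  congr (_ *m _); rewrite -!mulmxA; congr (_ *m _).
  rewrite map_diag_mx mulmx_diag; congr diag_mx.
  apply/rowP => j; rewrite !mxE /=.
  have h : 0 <= sqrtC (g (spectral_diag A 0 j)) by rewrite sqrtC_ge0.
  by rewrite (CrealP (ger0_real h)) -expr2 sqrtCK.
(* The positive and negative parts of [A], by functional calculus. *)
exists (D (fun x => (`|x| + x) / 2)), (D (fun x => (`|x| - x) / 2)); split.
- apply: psdD => i; rewrite divr_ge0 // -[X in _ + X]opprK subr_ge0 -normrN.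
  by rewrite real_ler_norm ?rpredN.
- by apply: psdD => i; rewrite divr_ge0 // subr_ge0 real_ler_norm.
- rewrite {1}(orthomx_spectralP nA) /D -mulmxBl -mulmxBr; congr (_ *m _ *m _).
  apply/matrixP => i j; rewrite !mxE -mulrnBl -mulrBl.
  by congr (_ *+ _); field.
- rewrite (trnorm_normal nA) !trD -big_split /=; apply: eq_bigr => i _.
  by field.
Qed.

(** In an eigenbasis of [P - N], each eigenvalue is a difference of nonnegative diagonal entries of
    [P] and [N], so its modulus is at most their sum. *)
Lemma trnorm_sub_le n (P N : 'M[C]_n) : psdmx P -> psdmx N ->
  trnorm (P - N) <= \tr P + \tr N.
Proof.
move=> hP hN; set A := P - N; set U := spectralmx A.
have uU : U \is unitarymx := spectral_unitarymx A.
have hA : A \is hermsymmx by apply: hermsymmx_psdB.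
have nA := hermitian_normalmx hA.
have psdU (B : 'M[C]_n) i : psdmx B -> 0 <= (U *m B *m U ^t*) i i.
  move=> /psdmx_gramE[G ->]; apply: psdmx_diag_ge0.
  have -> : U *m (G ^t* *m G) *m U ^t* = (G *m U ^t*) ^t* *m (G *m U ^t*).
    by rewrite trmx_mul map_mxM /= trmxCK !mulmxA.
  exact: psdmx_gram.
have trU (B : 'M[C]_n) : \tr B = \sum_i (U *m B *m U ^t*) i i.
  rewrite -[RHS]/(\tr _) mxtrace_mulC mulmxA -(invmx_unitary uU).
  by rewrite mulVmx ?mul1mx ?unitarymx_unit.
rewrite trnorm_normal // (trU P) (trU N) -big_split /=.
apply: ler_sum => i _.
have -> : spectral_diag A 0 i = (U *m P *m U ^t*) i i - (U *m N *m U ^t*) i i.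
  have : U *m A *m U ^t* = diag_mx (spectral_diag A).
    rewrite {1}(orthomx_spectralP nA) -/U -(invmx_unitary uU).
    by rewrite !mulmxA mulmxK ?mulmxV ?mul1mx ?unitarymx_unit.
  move=> /matrixP/(_ i i); rewrite [RHS]mxE eqxx mulr1n => <-.
  by rewrite /A mulmxBr mulmxBl !mxE.
by rewrite (le_trans (ler_normB _ _)) // !ger0_norm ?psdU.
Qed.

End TraceNorm.

(** * Maps tensored with the identity *)

Section Channels.
Variable C : numClosedFieldType.

Lemma big_mxtens m n (F : 'I_(m * n) -> C) :
  \sum_r F r = \sum_i \sum_j F (mxtens_index (i, j)).
Proof.
rewrite pair_bigA (reindex (@mxtens_index m n)) /=.
  by apply: eq_bigr => -[i j].
exists (@mxtens_unindex m n) => r _; last exact: mxtens_unindexK.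
exact: mxtens_indexK.
Qed.

Section Idtens.
Variables k m n : nat.

Lemma mxtens_block_idtens (Phi : 'M[C]_m -> 'M[C]_n) (X : 'M[C]_(k * m)) i j :
  mxtens_block (idtens Phi X) i j = Phi (mxtens_block X i j).
Proof. by apply/matrixP => a b; rewrite !mxE !mxtens_indexK. Qed.

Lemma mxtens_block_inj (X Y : 'M[C]_(k * n)) :
  (forall i j, mxtens_block X i j = mxtens_block Y i j) -> X = Y.
Proof.
move=> eXY; apply/matrixP => p q.
case: (mxtens_indexP p) => i a; case: (mxtens_indexP q) => j b.
by move/matrixP/(_ a b): (eXY i j); rewrite !mxE.
Qed.

Lemma mxtrace_idtens (Phi : 'M[C]_m -> 'M[C]_n) (X : 'M[C]_(k * m)) :
  trace_preserving Phi -> \tr (idtens Phi X) = \tr X.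
Proof.
move=> tPhi; rewrite /mxtrace !big_mxtens; apply: eq_bigr => i _.
transitivity (\tr (Phi (mxtens_block X i i))).
  by apply: eq_bigr => a _; rewrite mxE mxtens_indexK.
by rewrite tPhi; apply: eq_bigr => a _; rewrite mxE.
Qed.

HB.instance Definition _ (Phi : {linear 'M[C]_m -> 'M[C]_n}) :=
  GRing.isLinear.Build C 'M[C]_(k * m) 'M[C]_(k * n) *:%R
    (@idtens C k m n Phi) (idtens_is_linear (k := k) Phi).

End Idtens.

Lemma idtens_comp k m n p (Phi : 'M[C]_m -> 'M[C]_n) (Psi : 'M[C]_n -> 'M[C]_p)
    (Theta : 'M[C]_m -> 'M[C]_p) (X : 'M[C]_(k * m)) :
  (forall Z, Theta Z = Psi (Phi Z)) ->
  idtens Theta X = idtens Psi (idtens Phi X).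
Proof.
by move=> e; apply: mxtens_block_inj => i j; rewrite !mxtens_block_idtens e.
Qed.

Lemma idtens_id k m (Phi : 'M[C]_m -> 'M[C]_m) (X : 'M[C]_(k * m)) :
  (forall Z, Phi Z = Z) -> idtens Phi X = X.
Proof.
by move=> e; apply: mxtens_block_inj => i j; rewrite !mxtens_block_idtens e.
Qed.

(* [A] is a combination of the hermitian matrices [A + A ^t* ] and            *)
(* ['i *: (A - A ^t* )], whose images are hermitian.                          *)
Lemma positive_conj m n (Psi : {linear 'M[C]_m -> 'M[C]_n}) :
  (forall X, psdmx X -> psdmx (Psi X)) ->
  forall A, Psi (A ^t*) = (Psi A) ^t*.
Proof.
move=> pos A.
have herm (H : 'M[C]_m) : H ^t* = H -> (Psi H) ^t* = Psi H.
  move=> /hermsymmxP/trnorm_jordan[P [N [hP hN -> _]]].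
  by rewrite linearB; apply/hermsymmxP/hermsymmx_psdB; apply: pos.
have h1 : (Psi (A + A ^t*)) ^t* = Psi (A + A ^t*).
  by apply: herm; rewrite linearD map_mxD /= trmxCK addrC.
have h2 : (Psi ('i *: (A - A ^t*))) ^t* = Psi ('i *: (A - A ^t*)).
  apply: herm; rewrite linearZ /= map_mxZ linearB map_mxB /= trmxCK conjCi.
  by rewrite scaleNr -scalerN opprB.
move: h1 h2; rewrite linearZ /= linearB linearD /=.
rewrite linearD linearZ /= linearB /= map_mxD map_mxZ map_mxB /= conjCi.
set a := Psi A; set b := Psi _; set a' := _ ^t*; set b' := _ ^t* => h1.
rewrite scaleNr -scalerN => /(scalerI (neq0Ci _)); rewrite opprB => h2.
clearbody a b a' b'; apply/matrixP => i j.
move/matrixP/(_ i j): h2; move/matrixP/(_ i j): h1; rewrite !mxE => h1 h2.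
apply: (@mulfI _ 2); first by rewrite pnatr_eq0.
transitivity (a i j + b i j - (a i j - b i j)); first by ring.
by rewrite -h1 -h2; ring.
Qed.

(** * The Choi matrix and contraction of the trace norm *)

Definition choi m n (Phi : 'M[C]_m -> 'M[C]_n) : 'M[C]_(m * n) :=
  \matrix_(p, q)
    Phi (delta_mx (mxtens_unindex p).1 (mxtens_unindex q).1)
      (mxtens_unindex p).2 (mxtens_unindex q).2.

Lemma linear_choiE m n (Phi : {linear 'M[C]_m -> 'M[C]_n}) X a b :
  Phi X a b = \sum_i \sum_j
    X i j * choi Phi (mxtens_index (i, a)) (mxtens_index (j, b)).
Proof.
rewrite {1}(matrix_sum_delta X) linear_sum summxE; apply: eq_bigr => i _.
rewrite linear_sum summxE; apply: eq_bigr => j _.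
by rewrite linearZ !mxE !mxtens_indexK.
Qed.

(* Gram factors of [X] and of the Choi matrix combine to one of [idtens].     *)
Lemma choi_completely_positive m n (Phi : {linear 'M[C]_m -> 'M[C]_n}) :
  psdmx (choi Phi) -> completely_positive Phi.
Proof.
move=> /psdmx_gramE[B eB] k X /psdmx_gramE[G eX].
pose H : 'M[C]_((k * m) * (m * n), k * n) := \matrix_(r, p)
  \sum_i G (mxtens_unindex r).1 (mxtens_index ((mxtens_unindex p).1, i))
       * B (mxtens_unindex r).2 (mxtens_index (i, (mxtens_unindex p).2)).
suff -> : idtens Phi X = H ^t* *m H by apply: psdmx_gram.
apply/matrixP => p q; rewrite mxE linear_choiE eB eX [RHS]mxE big_mxtens.
set a := (mxtens_unindex p).2; set b := (mxtens_unindex q).2.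
set e := (mxtens_unindex p).1; set f := (mxtens_unindex q).1.
transitivity (\sum_i \sum_j \sum_g \sum_l
   (G g (mxtens_index (e, i)) * B l (mxtens_index (i, a)))^*
   * (G g (mxtens_index (f, j)) * B l (mxtens_index (j, b)))).
  apply: eq_bigr => i _; apply: eq_bigr => j _; rewrite !mxE big_distrlr /=.
  apply: eq_bigr => g _; apply: eq_bigr => l _; rewrite !mxE rmorphM.
  by ring.
rewrite exchange_big /= (eq_bigr _ (fun j _ => exchange_big _ _ _ _ _ _)) /=.
rewrite exchange_big /=; apply: eq_bigr => g _.
under eq_bigr do rewrite exchange_big /=.
rewrite exchange_big /=; apply: eq_bigr => l _.
rewrite !mxE !mxtens_indexK /= rmorph_sum big_distrlr /= exchange_big.
by [].
Qed.

(** The images of the positive and negative parts of [Y] decompose the image of [Y] with the same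
    total trace. *)
Lemma trnorm_idtens_le k m n (V : {linear 'M[C]_m -> 'M[C]_n})
    (Y : 'M[C]_(k * m)) :
  cptp V -> Y \is hermsymmx -> trnorm (idtens V Y) <= trnorm Y.
Proof.
move=> [cpV tpV] /trnorm_jordan[P [N [hP hN -> ->]]].
rewrite linearB /= -(mxtrace_idtens P tpV) -(mxtrace_idtens N tpV).
by apply: trnorm_sub_le; apply: cpV.
Qed.

Lemma psdmx_delta n (i : 'I_n) : psdmx (delta_mx i i : 'M[C]_n).
Proof.
suff -> : delta_mx i i = (delta_mx i i) ^t* *m delta_mx i i :> 'M[C]_n.
  exact: psdmx_gram.
by rewrite trmx_delta map_delta_mx mul_delta_mx.
Qed.

Lemma mxtrace_delta n (i : 'I_n) : \tr (delta_mx i i : 'M[C]_n) = 1.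
Proof.
rewrite /mxtrace (bigD1 i) //= big1 => [|a ai]; first by rewrite mxE eqxx addr0.
by rewrite mxE (negPf ai).
Qed.

(** * The traceless test matrix *)

Section MaximallyEntangled.
Variable d' : nat.
Let d := d'.+1.

Definition lift_index (p : 'I_(d * d)) : 'I_(d.+1 * d) :=
  mxtens_index (lift ord0 (mxtens_unindex p).1, (mxtens_unindex p).2).

Lemma lift_index_inj : injective lift_index.
Proof.
move=> p q; case: (mxtens_indexP p) => i a; case: (mxtens_indexP q) => j b.
rewrite /lift_index !mxtens_indexK => /(can_inj (@mxtens_indexK _ _)) e.
by have [/= -> ->] := (lift_inj (congr1 fst e), congr1 snd e).
Qed.

(* The vector [\sum_i e_(i+1) (x) e_i], which leaves the ancilla level [0]    *)
(* free.                                                                      *)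
Definition maxent_vec : 'rV[C]_(d.+1 * d) :=
  \row_p (unlift ord0 (mxtens_unindex p).1 == Some (mxtens_unindex p).2)%:R.

Definition maxent_mx := maxent_vec ^t* *m maxent_vec.

Let o : 'I_(d.+1 * d) := mxtens_index (ord0, ord0).

(** The factor [d] balances the trace of [maxent_mx]; the support lies at ancilla level 0, outside
    the range of [lift_index]. *)
Definition flag_mx : 'M[C]_(d.+1 * d) := d%:R *: delta_mx o o.

Lemma mxtrace_maxent : \tr maxent_mx = d%:R.
Proof.
rewrite /maxent_mx mxtrace_mulC trace_mx11 mxE big_mxtens big_ord_recl /=.
rewrite big1 ?add0r => [|a _]; last first.
  by rewrite !mxE mxtens_indexK /= unlift_none mul0r.
rewrite (eq_bigr (fun=> 1)) => [|i _]; first by rewrite sumr_const card_ord.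
rewrite (bigD1 i) //= big1 => [|a ai]; last first.
  rewrite !mxE mxtens_indexK /= liftK (inj_eq Some_inj).
  by rewrite eq_sym (negPf ai) mul0r.
by rewrite !mxE mxtens_indexK /= liftK eqxx conjC1 mulr1 addr0.
Qed.

Lemma mxtrace_flag : \tr flag_mx = d%:R.
Proof. by rewrite linearZ /= mxtrace_delta mulr1. Qed.

Lemma mxsub_idtens_maxent (V : {linear 'M[C]_d -> 'M[C]_d}) :
  mxsub lift_index lift_index (idtens V (maxent_mx - flag_mx)) = choi V.
Proof.
apply/matrixP => p q; rewrite !mxE !mxtens_indexK /=.
congr (V _ _ _); apply/matrixP => a b.
rewrite !mxE big_ord1 !mxE !mxtens_indexK /= !liftK !(inj_eq Some_inj).
rewrite mulr0 subr0.
by rewrite conjC_nat -natrM mulnb (eq_sym a) (eq_sym b).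
Qed.

Lemma mxtrace_choi (V : 'M[C]_d -> 'M[C]_d) :
  trace_preserving V -> \tr (choi V) = d%:R.
Proof.
move=> tV; rewrite /mxtrace big_mxtens.
rewrite (eq_bigr (fun=> 1)) => [|i _]; first by rewrite sumr_const card_ord.
transitivity (\tr (V (delta_mx i i))).
  by apply: eq_bigr => a _; rewrite mxE mxtens_indexK.
by rewrite tV mxtrace_delta.
Qed.

(* Since [tr P = tr N <= d = tr (choi V)], the lifted block of [P] has the    *)
(* whole trace of [P], and that of [N] has trace zero.                        *)
Lemma psdmx_choi (V : {linear 'M[C]_d -> 'M[C]_d}) (P N : 'M[C]_(d.+1 * d)) :
  trace_preserving V -> psdmx P -> psdmx N ->
  idtens V (maxent_mx - flag_mx) = P - N -> \tr P + \tr N <= d%:R + d%:R ->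
  psdmx (choi V).
Proof.
move=> tV hP hN eV leT; set f := lift_index.
have eC : choi V = mxsub f f P - mxsub f f N.
  by rewrite -mxsub_idtens_maxent eV; apply/matrixP => p q; rewrite !mxE.
have eT : \tr P = \tr N.
  apply/eqP; rewrite -subr_eq0 -linearB /= -eV mxtrace_idtens //.
  by rewrite linearB /= mxtrace_maxent mxtrace_flag subrr.
have leP : \tr P <= d%:R by move: leT; rewrite -eT -!mulr2n lerMn2r.
have hfN := psdmx_mxsub f hN.
suff fN0 : mxsub f f N = 0 by rewrite eC fN0 subr0; apply: psdmx_mxsub.
apply: psdmx_trace_eq0 => //; apply/eqP; rewrite eq_le psdmx_trace_ge0 // andbT.
have := mxtrace_choi tV; rewrite eC linearB /= => /eqP.
rewrite subr_eq => /eqP eD; rewrite -(lerD2l d%:R) addr0 -eD.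
exact: le_trans (psdmx_trace_mxsub_le lift_index_inj hP) leP.
Qed.

End MaximallyEntangled.

Lemma hermsymmx_state_diff n (i0 : 'I_n) (X : 'M[C]_n) :
  X \is hermsymmx -> \tr X = 0 ->
  exists (c : C) (rho1 rho2 : 'M[C]_n),
    [/\ 0 < c, state rho1, state rho2 & X = c *: (rho1 - rho2)].
Proof.
move=> /trnorm_jordan[P [N [hP hN eX _]]] tX.
have eT : \tr P = \tr N by apply/eqP; rewrite -subr_eq0 -linearB /= -eX tX.
(* Adding the same [D] to both parts leaves the difference unchanged and keeps the normalization [c]
   positive even when [X] is zero. *)
pose c := \tr P + 1; pose D : 'M[C]_n := delta_mx i0 i0.
have c0 : 0 < c by rewrite ltr_wpDl ?psdmx_trace_ge0.
have st Q : psdmx Q -> \tr Q = \tr P -> state (c^-1 *: (Q + D)).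
  move=> hQ tQ; split.
    by apply/psdmxZ/psdmxD => //; [rewrite invr_ge0 ltW|apply: psdmx_delta].
  by rewrite linearZ linearD /= tQ mxtrace_delta mulVf // gt_eqF.
exists c, (c^-1 *: (P + D)), (c^-1 *: (N + D)); split=> //; try exact: st.
by rewrite -scalerBr scalerA divff ?gt_eqF // scale1r opprD addrACA subrr addr0.
Qed.

End Channels.

(** * Divisibility and contraction *)

Theorem theorem1 (R : realType) (d : nat) (hd : (1 <= d)%N)
    (Lambda : R -> {linear 'M[R[i]]_d -> 'M[R[i]]_d})
    (hcptp : forall t : R, 0 <= t -> cptp (Lambda t))
    (h0 : forall X : 'M[R[i]]_d, Lambda 0 X = X)
    (hbij : forall t : R, 0 <= t -> bijective (Lambda t)) :
  cp_divisible Lambda <->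
  (forall rho1 rho2 : 'M[R[i]]_(d.+1 * d), state rho1 -> state rho2 ->
   forall s t : R, 0 <= s -> s < t ->
   trnorm (idtens (k:=d.+1) (Lambda t) (rho1 - rho2))
     <= trnorm (idtens (k:=d.+1) (Lambda s) (rho1 - rho2))).
Proof.
case: d hd Lambda hcptp h0 hbij => [//|d'] _ Lambda hcptp _ hbij.
have pos t k (X : 'M_(k * _)) :
    0 <= t -> psdmx X -> psdmx (idtens (Lambda t) X).
  by move=> t0; apply: (hcptp t t0).1.
split=> [div rho1 rho2 [h1 _] [h2 _] s t s0 st | mono s t s0].
  have [V [cV eV]] := div s t s0 (ltW st).
  rewrite (idtens_comp _ eV); apply: trnorm_idtens_le => //.
  by rewrite linearB; apply: hermsymmx_psdB; apply: pos.
rewrite le_eqVlt => /predU1P[<-|st].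
  exists idfun; split=> //; split=> // k X hX.
  by rewrite idtens_id.
have t0 := ltW (le_lt_trans s0 st).
have [g gK Kg] := hbij s s0.
pose G : {linear 'M[R[i]]_d'.+1 -> 'M[R[i]]_d'.+1} :=
  HB.pack g (GRing.isLinear.Build _ _ _ _ g (can2_linear gK Kg)).
pose V : {linear 'M[R[i]]_d'.+1 -> 'M[R[i]]_d'.+1} := Lambda t \o G.
have eV X : Lambda t X = V (Lambda s X) by rewrite /= gK.
have tG : trace_preserving g.
  by move=> X; rewrite -[in RHS](Kg X) (hcptp s s0).2.
have tV : trace_preserving V.
  by move=> X; rewrite /= (hcptp t t0).2 tG.
exists V; split=> //; split=> //; apply: choi_completely_positive.
pose Z : 'M[R[i]]_(d'.+2 * d'.+1) := maxent_mx _ d' - flag_mx _ d'.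
pose X := idtens g Z.
have eZ : Z = idtens (Lambda s) X.
  by rewrite -(idtens_comp (Theta := idfun)) ?idtens_id.
have psdM : psdmx (maxent_mx R[i] d') by apply: psdmx_gram.
have psdF : psdmx (flag_mx R[i] d').
  by apply: psdmxZ (psdmx_delta _ _); rewrite ler0n.
have tX : \tr X = 0.
  by rewrite mxtrace_idtens // linearB /= mxtrace_maxent mxtrace_flag subrr.
(* The inverse [g] need not be positive, so hermiticity is pulled back instead: [idtens (Lambda s)]
   is injective, commutes with the adjoint, and sends [X] to the hermitian [Z]. *)
have hX : X \is hermsymmx.
  have posS Y : psdmx Y -> psdmx (idtens (k := d'.+2) (Lambda s) Y).
    exact: pos.
  have injS : injective (idtens (k := d'.+2) (Lambda s)).
    apply: (can_inj (g := idtens g)) => Y.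
    by rewrite -(idtens_comp (Theta := idfun)) ?idtens_id.
  apply/hermsymmxP/injS; rewrite (positive_conj posS) /= -eZ.
  exact/hermsymmxP/(hermsymmx_psdB psdM psdF).
have [c [rho1 [rho2 [c0 h1 h2 eX]]]] :=
  hermsymmx_state_diff (mxtens_index (ord0, ord0)) hX tX.
have hY : idtens (Lambda t) (rho1 - rho2) \is hermsymmx.
  have [[pr1 _] [pr2 _]] := (h1, h2).
  rewrite linearB /=.
  exact: hermsymmx_psdB (pos t _ _ t0 pr1) (pos t _ _ t0 pr2).
have [P [N [hP hN eY eT]]] := trnorm_jordan hY.
have hcP := psdmxZ (ltW c0) hP; have hcN := psdmxZ (ltW c0) hN.
have eVZ : idtens V Z = c *: P - c *: N.
  by rewrite eZ -(idtens_comp _ eV) eX linearZ /= eY scalerBr.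
apply: (psdmx_choi tV hcP hcN eVZ).
(* The traces of [P] and [N] sum to the trace norm at time [t], hence at most that at time [s],
   where the matrix is [c^-1 *: Z], of trace norm at most [2d / c]. *)
rewrite !linearZ /= -mulrDr -eT -ler_pdivlMl //.
apply: le_trans (mono rho1 rho2 h1 h2 s t s0 st) _.
have -> : idtens (Lambda s) (rho1 - rho2)
        = c^-1 *: maxent_mx _ d' - c^-1 *: flag_mx _ d'.
  rewrite -scalerBr -/Z eZ eX [in RHS]linearZ /= scalerA mulVf ?gt_eqF //.
  by rewrite scale1r.
have ci0 : 0 <= c^-1 by rewrite invr_ge0 ltW.
apply: le_trans (trnorm_sub_le (psdmxZ ci0 psdM) (psdmxZ ci0 psdF)) _.
by rewrite mxtraceZ mxtrace_maxent mxtraceZ mxtrace_flag mulrDr.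
Qed.
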